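(* Let $R$, $S$ be two super rings, and let $F:\mathfrak{M}_R\to\mathfrak{M}_S$ and $G:\mathfrak{M}_S\to\mathfrak{M}_R$ be mutually inverse category equivalences. Let $Q=F(R_R)$ and $P=G(S_S)$. Then there are natural bimodule structures $P={}_SP_R$ and $Q={}_RQ_S$ (an $(S,R)$-bimodule structure on $P$ and an $(R,S)$-bimodule structure on $Q$), which yield functor isomorphisms $F\cong -\otimes_R Q$ and $G\cong -\otimes_S P$.
   Context: A super ring is an associative (not necessarily commutative) unital ring $R=R_0\oplus R_1$ graded by $\mathbb{Z}_2$ with $R_iR_j\subseteq R_{i+j}$. All modules and bimodules are $\mathbb{Z}_2$-graded with actions compatible with the grading. $\mathfrak{M}_R$ is the category of right graded $R$-modules whose morphisms are the parity-preserving $R$-module homomorphisms. $R_R$ and $S_S$ denote $R$ and $S$ regarded as right modules over themselves. The bimodule structures on $P$ and $Q$ extend the given right $R$-module structure on $P$ and right $S$-module structure on $Q$. The tensor product of graded modules is the usual one with grading $(M\otimes_R N)_k=\bigoplus_{i+j=k}M_i\otimes_R N_j$.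
   Formalization: F and G are also assumed to extend functorially to parity-reversing module homomorphisms; without this the claim fails (R=S=K×K purely even, F swaps the two factors on even parts only), and it is necessary, since −⊗Q always extends this way. *)

(* Defs.v *)
(* Classical axioms (boolp) are used to identify extensionally equal morphisms
   and to take quotients by undecidable subgroups. *)
From HB Require Import structures.
From mathcomp Require Import all_boot all_order all_algebra.
From mathcomp Require Import generic_quotient.
From mathcomp Require Import boolp.
From mathcomp Require Import freeg.

Set Implicit Arguments.
Unset Strict Implicit.
Unset Printing Implicit Defensive.
Import GRing.Theory.
Local Open Scope ring_scope.

(* The group Z/2 is (bool, addb): false is the even degree, true the odd one. *)
Record grading (V : zmodType) := Grading {
  homog : bool -> V -> Prop;
  homog_zmod : forall i, homog i 0 /\
    (forall x y, homog i x -> homog i y -> homog i (x - y));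
  homog_span : forall x, exists x0 x1,
    [/\ homog false x0, homog true x1 & x = x0 + x1];
  homog_direct : forall x, homog false x -> homog true x -> x = 0
}.

Record superRing := SuperRing {
  sring :> pzRingType;
  sgrading : grading sring;
  shomogM : forall i j (a b : sring), homog sgrading i a ->
    homog sgrading j b -> homog sgrading (i (+) j) (a * b)
}.

(* Right R-modules are left modules over the converse ring R^c, as usual in
   MathComp: for r : R and m : M, the term r *: m stands for m.r. *)
Record gmod (R : superRing) := GMod {
  gcarrier :> lmodType R^c;
  ggrading : grading gcarrier;
  ghomogZ : forall i j (m : gcarrier) (r : R), homog ggrading i m ->
    homog (sgrading R) j r -> homog ggrading (i (+) j) ((r : R^c) *: m)
}.

(* R-linear maps homogeneous of degree i: parity-preserving for i = false,
   parity-reversing for i = true. *)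
Record ghom (R : superRing) (i : bool) (M N : gmod R) := GHom {
  ghom_fun :> M -> N;
  ghom_linear : linear ghom_fun;
  ghom_homog : forall j x, homog (ggrading M) j x ->
    homog (ggrading N) (i (+) j) (ghom_fun x)
}.

Lemma ghomP (R : superRing) i (M N : gmod R) (f g : ghom i M N) :
  f =1 g -> f = g.
Proof.
case: f g => [f fl fh] [g gl gh] /= /funext fg; rewrite {}fg in fl fh *.
by congr GHom; exact: Prop_irrelevance.
Qed.

Section GHomCat.
Variable R : superRing.
Implicit Types M N P : gmod R.

Lemma gid_linear M : linear (@id M). Proof. by []. Qed.

Definition gid M : ghom false M M :=
  @GHom R false M M id (@gid_linear M) (fun j x hx => hx).

Lemma gcomp_linear i j M N P (g : ghom i N P) (f : ghom j M N) :
  linear (g \o f).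
Proof. by move=> a x y /=; rewrite !ghom_linear. Qed.

Lemma gcomp_homog i j M N P (g : ghom i N P) (f : ghom j M N) k x :
  homog (ggrading M) k x -> homog (ggrading P) (i (+) j (+) k) ((g \o f) x).
Proof. by move=> hx; rewrite -addbA; do 2!apply: ghom_homog. Qed.

Definition gcomp i j M N P (g : ghom i N P) (f : ghom j M N) :
    ghom (i (+) j) M P :=
  GHom (gcomp_linear g f) (gcomp_homog g f).

End GHomCat.

Record category := Category {
  obj :> Type;
  mor : obj -> obj -> Type;
  idm : forall X, mor X X;
  comp : forall X Y Z, mor Y Z -> mor X Y -> mor X Z;
  comp1m : forall X Y (f : mor X Y), comp (idm Y) f = f;
  compm1 : forall X Y (f : mor X Y), comp f (idm X) = f;
  compA : forall X Y Z W (h : mor Z W) (g : mor Y Z) (f : mor X Y),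
    comp h (comp g f) = comp (comp h g) f
}.
Arguments mor {c} X Y.
Arguments idm {c} X.
Arguments comp {c X Y Z} g f.

Record functor (C D : category) := Functor {
  fobj :> C -> D;
  fmap : forall X Y, mor X Y -> mor (fobj X) (fobj Y);
  fmap1 : forall X, fmap (idm X) = idm (fobj X);
  fmapM : forall X Y Z (g : mor Y Z) (f : mor X Y),
    fmap (comp g f) = comp (fmap g) (fmap f)
}.
Arguments fmap {C D} F {X Y} f : rename.

Definition functor_id (C : category) : functor C C :=
  @Functor C C (fun X => X) (fun X Y f => f) (fun=> erefl)
    (fun X Y Z g f => erefl).

Section FunctorComp.
Variables (C D E : category) (G : functor D E) (F : functor C D).

Lemma fcomp1 X : fmap G (fmap F (idm X)) = idm (G (F X)).
Proof. by rewrite !fmap1. Qed.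

Lemma fcompM X Y Z (g : mor Y Z) (f : mor X Y) :
  fmap G (fmap F (comp g f)) = comp (fmap G (fmap F g)) (fmap G (fmap F f)).
Proof. by rewrite !fmapM. Qed.

Definition functor_comp : functor C E :=
  @Functor C E (fun X => G (F X)) (fun X Y f => fmap G (fmap F f))
    fcomp1 fcompM.
End FunctorComp.

Definition nat_isomorphic (C D : category) (F G : functor C D) : Prop :=
  exists (eta : forall X, mor (F X) (G X)) (eta' : forall X, mor (G X) (F X)),
  [/\ forall X Y (f : mor X Y), comp (eta Y) (fmap F f) = comp (fmap G f) (eta X),
      forall X, comp (eta' X) (eta X) = idm (F X)
    & forall X, comp (eta X) (eta' X) = idm (G X)].

Definition mutually_inverse (C D : category)
    (F : functor C D) (G : functor D C) : Prop :=
  nat_isomorphic (functor_comp G F) (functor_id C) /\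
  nat_isomorphic (functor_comp F G) (functor_id D).

Section GModCat.
Variable R : superRing.

Lemma gcomp1m (M N : gmod R) (f : ghom false M N) : gcomp (gid N) f = f.
Proof. exact: ghomP. Qed.

Lemma gcompm1 (M N : gmod R) (f : ghom false M N) : gcomp f (gid M) = f.
Proof. exact: ghomP. Qed.

Lemma gcompA (M N P Q : gmod R)
    (h : ghom false P Q) (g : ghom false N P) (f : ghom false M N) :
  gcomp h (gcomp g f) = gcomp (gcomp h g) f :> ghom false M Q.
Proof. exact: ghomP. Qed.

(* Graded right R-modules and parity-preserving homomorphisms. *)
Definition gmodCat : category :=
  @Category (gmod R) (@ghom R false) (@gid R) (@gcomp R false false)
    gcomp1m gcompm1 gcompA.
End GModCat.

Section Regular.
Variable R : superRing.

Lemma reg_homogZ i j (m : R^c^o) (r : R) : homog (sgrading R) i m ->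
  homog (sgrading R) j r -> homog (sgrading R) (i (+) j) ((r : R^c) *: m).
Proof. exact: shomogM. Qed.

(* R^c^o is the ring R with r *: m = m * r, i.e. R as a right module. *)
Definition reg : gmod R := @GMod R (R^c^o : lmodType R^c) (sgrading R) reg_homogZ.

Variables (i : bool) (r : R) (hr : homog (sgrading R) i r).

Lemma lmul_linear : linear (fun x : reg => (r * x : R) : reg).
Proof. by move=> a x y /=; rewrite mulrDr; congr (_ + _); exact: (@mulrA R). Qed.

Lemma lmul_homog j (x : reg) : homog (ggrading reg) j x ->
  homog (ggrading reg) (i (+) j) ((r * x : R) : reg).
Proof. exact: shomogM. Qed.

Definition lmul : ghom i reg reg := GHom lmul_linear lmul_homog.
End Regular.


Section Bimodule.
Variables (R S : superRing).

(* An (R, S)-bimodule structure extending the right S-module structure of Q. *)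
Record bimodule (Q : gmod S) := Bimodule {
  lact : R -> Q -> Q;
  lactDl : forall r r' q, lact (r + r') q = lact r q + lact r' q;
  lactDr : forall r q q', lact r (q + q') = lact r q + lact r q';
  lactM : forall r r' q, lact (r * r') q = lact r (lact r' q);
  lact1 : forall q, lact 1 q = q;
  lactZ : forall r (s : S) q, lact r ((s : S^c) *: q) = (s : S^c) *: lact r q;
  lact_homog : forall i j r q, homog (sgrading R) i r ->
    homog (ggrading Q) j q -> homog (ggrading Q) (i (+) j) (lact r q)
}.
End Bimodule.


Section GradingParts.
Variables (V : zmodType) (g : grading V).

Lemma gpart_exists x : {y : V * V |
  [/\ homog g false y.1, homog g true y.2 & x = y.1 + y.2]}.
Proof.
by apply: cid; have [x0 [x1 hx]] := homog_span g x; exists (x0, x1).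
Qed.

(* The component of degree i. *)
Definition gpart (i : bool) (x : V) : V :=
  if i then (sval (gpart_exists x)).2 else (sval (gpart_exists x)).1.

Lemma homog0 i : homog g i 0. Proof. by case: (homog_zmod g i). Qed.

Lemma homogB i x y : homog g i x -> homog g i y -> homog g i (x - y).
Proof. by case: (homog_zmod g i) => _; apply. Qed.

Lemma homogN i x : homog g i x -> homog g i (- x).
Proof. by rewrite -sub0r; apply: homogB; exact: homog0. Qed.

Lemma homogD i x y : homog g i x -> homog g i y -> homog g i (x + y).
Proof. by move=> hx hy; rewrite -[y]opprK; apply/homogB/homogN. Qed.

Lemma gpart_homog i x : homog g i (gpart i x).
Proof. by rewrite /gpart; case: i; case: (svalP (gpart_exists x)). Qed.

Lemma gpartE x : x = gpart false x + gpart true x.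
Proof. by rewrite /gpart; case: (svalP (gpart_exists x)). Qed.

Lemma gpart_unique x0 x1 : homog g false x0 -> homog g true x1 ->
  gpart false (x0 + x1) = x0 /\ gpart true (x0 + x1) = x1.
Proof.
move=> h0 h1; have /eqP := gpartE (x0 + x1); set y0 := gpart false _.
set y1 := gpart true _ => e.
have d : x0 - y0 = y1 - x1.
  by apply/eqP; rewrite subr_eq addrAC eq_sym subr_eq eq_sym [y1 + _]addrC.
have z : x0 - y0 = 0.
  apply: (homog_direct (g := g)); first exact/homogB/gpart_homog.
  by rewrite d; apply: homogB => //; exact: gpart_homog.
by split; apply/esym/eqP; rewrite -subr_eq0 ?z // -opprB -d z oppr0.
Qed.

Lemma gpartD i : {morph gpart i : x y / x + y}.
Proof.
move=> x y; rewrite {1}(gpartE x) {1}(gpartE y) addrACA.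
have [] := @gpart_unique (gpart false x + gpart false y) (gpart true x + gpart true y).
- exact/homogD/gpart_homog/gpart_homog.
- exact/homogD/gpart_homog/gpart_homog.
by case: i.
Qed.

Lemma gpart_id i x : homog g i x -> gpart i x = x.
Proof.
case: i => h; first by rewrite -{1}[x]add0r; apply: (gpart_unique (homog0 _) h).2.
by rewrite -{1}[x]addr0; apply: (gpart_unique h (homog0 _)).1.
Qed.

Lemma gpart_neq i x : homog g (~~ i) x -> gpart i x = 0.
Proof.
case: i => h; first by rewrite -[x]addr0; apply: (gpart_unique h (homog0 _)).2.
by rewrite -[x]add0r; apply: (gpart_unique (homog0 _) h).1.
Qed.

End GradingParts.

Lemma gpart_bilin (U V W : zmodType) (gU : grading U) (gV : grading V)
    (gW : grading W) (b : U -> V -> W) :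
  (forall x x' y, b (x + x') y = b x y + b x' y) ->
  (forall x y y', b x (y + y') = b x y + b x y') ->
  (forall i j x y, homog gU i x -> homog gV j y -> homog gW (i (+) j) (b x y)) ->
  forall k x y, gpart gW k (b x y) =
    b (gpart gU false x) (gpart gV k y) + b (gpart gU true x) (gpart gV (~~ k) y).
Proof.
move=> bl br bh k x y.
set x0 := gpart gU false x; set x1 := gpart gU true x.
pose y0 := gpart gV false y; pose y1 := gpart gV true y.
have -> : b x y = (b x0 y0 + b x1 y1) + (b x0 y1 + b x1 y0).
  rewrite [in LHS](gpartE gU x) [in LHS](gpartE gV y) bl !br.
  by rewrite [b x1 _ + _]addrC addrACA.
have h i j : homog gW (i (+) j) (b (gpart gU i x) (gpart gV j y)).
  by apply: bh; exact: gpart_homog.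
have [] := @gpart_unique _ gW (b x0 y0 + b x1 y1) (b x0 y1 + b x1 y0).
- exact: homogD (h false false) (h true true).
- exact: homogD (h false true) (h true false).
by case: k.
Qed.

Section TensorGroup.
Variables (R S : superRing) (Q : gmod S) (B : bimodule R Q) (M : gmod R).

Definition tens_free : zmodType := {freeg (M * Q)%type / int}.

Definition fpure (m : M) (q : Q) : tens_free := << (m, q) >>.

Inductive tens_rel : tens_free -> Prop :=
| TensRel0 : tens_rel 0
| TensRelB x y : tens_rel x -> tens_rel y -> tens_rel (x - y)
| TensRelDl m m' q :
    tens_rel (fpure (m + m') q - (fpure m q + fpure m' q))
| TensRelDr m q q' :
    tens_rel (fpure m (q + q') - (fpure m q + fpure m q'))
| TensRelZ m (r : R) q :
    tens_rel (fpure ((r : R^c) *: m) q - fpure m (lact B r q)).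

Definition tens_ker : {pred tens_free} := fun x => `[< tens_rel x >].

Lemma tens_ker_closed : zmod_closed tens_ker.
Proof.
split=> [|x y /asboolP hx /asboolP hy]; apply/asboolP; first exact: TensRel0.
exact: TensRelB.
Qed.

HB.instance Definition _ := GRing.isZmodClosed.Build tens_free tens_ker
  tens_ker_closed.

Definition tens : Type := Quotient.quot tens_ker.
HB.instance Definition _ := GRing.Zmodule.on tens.

Definition pure (m : M) (q : Q) : tens := (\pi_(Quotient.quot tens_ker) (fpure m q))%qT.

Lemma tens_eq (x y : tens_free) : tens_rel (x - y) ->
  (\pi_(Quotient.quot tens_ker) x = \pi_(Quotient.quot tens_ker) y)%qT.
Proof. by move=> h; apply/eqP; rewrite -Quotient.idealrBE; apply/asboolP. Qed.

Lemma pureDl m m' q : pure (m + m') q = pure m q + pure m' q.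
Proof. by rewrite /pure -raddfD; apply/tens_eq/TensRelDl. Qed.

Lemma pureDr m q q' : pure m (q + q') = pure m q + pure m q'.
Proof. by rewrite /pure -raddfD; apply/tens_eq/TensRelDr. Qed.

Lemma pureZ m (r : R) q : pure ((r : R^c) *: m) q = pure m (lact B r q).
Proof. exact/tens_eq/TensRelZ. Qed.

Lemma pure0 q : pure 0 q = 0.
Proof. by apply: (@addrI _ (pure 0 q)); rewrite -pureDl !addr0. Qed.

Lemma pure0r m : pure m 0 = 0.
Proof. by apply: (@addrI _ (pure m 0)); rewrite -pureDr !addr0. Qed.

Lemma pureN m q : pure (- m) q = - pure m q.
Proof. by apply/eqP; rewrite -addr_eq0 -pureDl addNr pure0. Qed.

Lemma tens_ind (P : tens -> Prop) :
  P 0 -> (forall x y, P x -> P y -> P (x + y)) -> (forall m q, P (pure m q)) ->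
  forall t, P t.
Proof.
move=> P0 PD Pp t; rewrite -[t]reprK -[repr t]freeg_sumE raddf_sum.
apply: big_ind => // -[m q] _; set c := coeff _ _.
have -> : << c *g (m, q) >> = << (m, q) >> *~ c :> tens_free.
  by rewrite freegU_mulz intz.
have Pn n m' : P (pure m' q *+ n).
  by elim: n => [|n IHn]; rewrite ?mulr0n // mulrS; apply: PD.
rewrite raddfMz -/(pure m q); case: c => n; first by rewrite -pmulrn; exact: Pn.
by rewrite NegzE mulrNz -mulNrz -pureN -pmulrn; exact: Pn.
Qed.

Definition balanced (V : zmodType) (f : M -> Q -> V) :=
  [/\ forall m m' q, f (m + m') q = f m q + f m' q,
      forall m q q', f m (q + q') = f m q + f m q'
    & forall m (r : R) q, f ((r : R^c) *: m) q = f m (lact B r q)].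

Section Lift.
Variables (V : zmodType) (f : M -> Q -> V).

Definition flift : tens_free -> V :=
  fglift (fun mq : M * Q => f mq.1 mq.2 : zmodule V).

Definition tens_lift (t : tens) : V := flift (repr t).

Lemma flift_additive : zmod_morphism flift.
Proof. exact: (@lift_is_additive int (M * Q)%type (zmodule V)). Qed.

Hypothesis fbal : balanced f.

Lemma flift_pure m q : flift (fpure m q) = f m q.
Proof. by rewrite /flift /fpure liftU. Qed.

Lemma flift_rel x : tens_rel x -> flift x = 0.
Proof.
have fD y z : flift (y + z) = flift y + flift z.
  have f0 : flift 0 = 0 by rewrite -[0 in LHS](subrr 0) flift_additive subrr.
  have fN u : flift (- u) = - flift u by rewrite -sub0r flift_additive f0 sub0r.
  by rewrite -[z in LHS]opprK flift_additive fN opprK.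
case: fbal => fl fr fz.
elim=> [|y z _ hy _ hz|m m' q|m q q'|m r q]; rewrite ?flift_additive.
- by rewrite -[0 in LHS](subrr 0) flift_additive subrr.
- by rewrite hy hz subrr.
- by rewrite fD !flift_pure fl subrr.
- by rewrite fD !flift_pure fr subrr.
- by rewrite !flift_pure fz subrr.
Qed.

Lemma tens_liftE x : tens_lift (\pi_(Quotient.quot tens_ker) x)%qT = flift x.
Proof.
apply/eqP; rewrite -subr_eq0 -flift_additive; apply/eqP/flift_rel/asboolP.
have := Quotient.idealrBE tens_ker (repr (\pi_(Quotient.quot tens_ker) x)%qT) x.
by rewrite reprK eqxx.
Qed.

Lemma tens_lift_additive : zmod_morphism tens_lift.
Proof.
move=> x y; rewrite -[x]reprK -[y]reprK -raddfB !tens_liftE.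
exact: flift_additive.
Qed.

Lemma tens_liftD : {morph tens_lift : x y / x + y}.
Proof.
move=> x y.
have f0 : tens_lift 0 = 0 by rewrite -[0 in LHS](subrr 0) tens_lift_additive subrr.
by rewrite -[y in LHS]opprK -[- y]sub0r !tens_lift_additive f0 sub0r opprK.
Qed.

Lemma tens_lift0 : tens_lift 0 = 0.
Proof. by rewrite -[0 in LHS](subrr 0) tens_lift_additive subrr. Qed.

Lemma tens_lift_pure m q : tens_lift (pure m q) = f m q.
Proof. by rewrite tens_liftE flift_pure. Qed.

End Lift.
End TensorGroup.

Section TensorModule.
Variables (R S : superRing) (Q : gmod S) (B : bimodule R Q) (M : gmod R).
Local Notation T := (tens B M).
Local Notation pure := (@pure R S Q B M).

(* (M (x) Q)_k is the subgroup generated by the M_i (x) Q_j with i + j = k. *)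
Inductive tens_homog (k : bool) : T -> Prop :=
| TensHomog0 : tens_homog k 0
| TensHomogD x y : tens_homog k x -> tens_homog k y -> tens_homog k (x + y)
| TensHomogPure i j m q : i (+) j = k -> homog (ggrading M) i m ->
    homog (ggrading Q) j q -> tens_homog k (pure m q).

Lemma tens_homog_zmod k : tens_homog k 0 /\
  (forall x y, tens_homog k x -> tens_homog k y -> tens_homog k (x - y)).
Proof.
split=> [|x y hx hy]; first exact: TensHomog0.
apply: TensHomogD => //; elim: hy => {x hx y}.
- by rewrite oppr0; exact: TensHomog0.
- by move=> x y _ hx _ hy; rewrite opprD; exact: TensHomogD.
- move=> i j m q ij hm hq; rewrite -pureN.
  by apply: TensHomogPure ij _ hq; exact: homogN.
Qed.

Lemma tens_homog_span t : exists t0 t1,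
  [/\ tens_homog false t0, tens_homog true t1 & t = t0 + t1].
Proof.
elim/tens_ind: t => [|x y [x0 [x1 [h0 h1 ->]]] [y0 [y1 [k0 k1 ->]]]|m q].
- by exists 0, 0; split; rewrite ?addr0 //; exact: TensHomog0.
- exists (x0 + y0), (x1 + y1); split; first exact: TensHomogD.
    exact: TensHomogD.
  by rewrite addrACA.
pose m' i := gpart (ggrading M) i m; pose q' i := gpart (ggrading Q) i q.
have h i j k : i (+) j = k -> tens_homog k (pure (m' i) (q' j)).
  by move/TensHomogPure; apply; exact: gpart_homog.
exists (pure (m' false) (q' false) + pure (m' true) (q' true)).
exists (pure (m' false) (q' true) + pure (m' true) (q' false)).
split; [by apply: TensHomogD; apply: h | by apply: TensHomogD; apply: h |].
rewrite [in LHS](gpartE (ggrading M) m) [in LHS](gpartE (ggrading Q) q).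
by rewrite pureDl !pureDr [pure (m' true) _ + _]addrC addrACA.
Qed.

Let proj0 (m : M) (q : Q) : T :=
  pure (gpart (ggrading M) false m) (gpart (ggrading Q) false q) +
  pure (gpart (ggrading M) true m) (gpart (ggrading Q) true q).

Let proj0_balanced : balanced B proj0.
Proof.
split=> [m m' q|m q q'|m r q]; rewrite /proj0.
- by rewrite !gpartD !pureDl addrACA.
- by rewrite !gpartD !pureDr addrACA.
have hM k := @gpart_bilin _ _ _ (ggrading M) (sgrading R) (ggrading M)
  (fun m (r : R) => (r : R^c) *: m) (fun _ _ _ => scalerDr _ _ _)
  (fun _ _ _ => scalerDl _ _ _) (@ghomogZ R M) k m r.
have hQ k := @gpart_bilin _ _ _ (sgrading R) (ggrading Q) (ggrading Q)
  (@lact _ _ _ B) (lactDl B) (lactDr B) (@lact_homog _ _ _ B) k r q.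
rewrite !hM !hQ /= !pureDl !pureDr !pureZ addrACA.
by congr (_ + _); exact: addrC.
Qed.

Lemma tens_homog_direct t : tens_homog false t -> tens_homog true t -> t = 0.
Proof.
pose p := tens_lift (B := B) proj0.
have p0 : p 0 = 0 := tens_lift0 proj0_balanced.
have pD : {morph p : x y / x + y} := tens_liftD proj0_balanced.
have pp m q : p (pure m q) = proj0 m q := tens_lift_pure proj0_balanced m q.
move=> h0 h1.
have <- : p t = t.
  elim: h0 => [|x y _ hx _ hy|i j m q]; first exact: p0.
    by rewrite pD hx hy.
  case: i j => [] [] // _ hm hq; rewrite pp /proj0 !(gpart_id hm, gpart_id hq).
    by rewrite (@gpart_neq _ _ false m) // pure0 add0r.
  by rewrite (@gpart_neq _ _ true m) // pure0 addr0.
elim: h1 => [|x y _ hx _ hy|i j m q]; first exact: p0.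
  by rewrite pD hx hy addr0.
case: i j => [] [] // _ hm hq; rewrite pp /proj0.
  by rewrite (@gpart_neq _ _ false m) // (@gpart_neq _ _ true q) // pure0 pure0r addr0.
by rewrite (@gpart_neq _ _ true m) // (@gpart_neq _ _ false q) // pure0 pure0r addr0.
Qed.

Definition tens_act (s : S^c) : T -> T :=
  tens_lift (B := B) (fun m q => pure m (s *: q)).

Lemma tens_act_balanced (s : S^c) : balanced B (fun m q => pure m (s *: q)).
Proof.
split=> [m m' q|m q q'|m r q]; first by rewrite pureDl.
  by rewrite scalerDr pureDr.
by rewrite pureZ lactZ.
Qed.

Lemma tens_act_pure s m q : tens_act s (pure m q) = pure m (s *: q).
Proof. exact: (tens_lift_pure (tens_act_balanced s)). Qed.

Lemma tens_actDr : right_distributive tens_act +%R.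
Proof. move=> s; exact: (tens_liftD (tens_act_balanced s)). Qed.

Lemma tens_act0 s : tens_act s 0 = 0.
Proof. exact: (tens_lift0 (tens_act_balanced s)). Qed.

Lemma tens_actA s s' t : tens_act s (tens_act s' t) = tens_act (s * s') t.
Proof.
elim/tens_ind: t => [|x y hx hy|m q]; rewrite ?tens_act0 //.
  by rewrite !tens_actDr hx hy.
by rewrite !tens_act_pure scalerA.
Qed.

Lemma tens_act1 : left_id 1 tens_act.
Proof.
elim/tens_ind => [|x y hx hy|m q]; rewrite ?tens_act0 //.
  by rewrite !tens_actDr hx hy.
by rewrite !tens_act_pure scale1r.
Qed.

Lemma tens_actDl t : {morph tens_act^~ t : s s' / s + s'}.
Proof.
move=> s s'; elim/tens_ind: t => [|x y hx hy|m q] /=.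
- by rewrite !tens_act0 addr0.
- by rewrite !tens_actDr hx hy addrACA.
by rewrite !tens_act_pure scalerDl pureDr.
Qed.

HB.instance Definition _ := GRing.Zmodule_isLmodule.Build S^c (tens B M)
  tens_actA tens_act1 tens_actDr tens_actDl.

Definition tens_grading : grading T :=
  Grading tens_homog_zmod tens_homog_span tens_homog_direct.

Lemma tens_homogZ i j (t : T) (s : S) : homog tens_grading i t ->
  homog (sgrading S) j s -> homog tens_grading (i (+) j) ((s : S^c) *: t).
Proof.
move=> ht hs; elim: ht => [|x y _ hx _ hy|a b m q ab hm hq].
- by rewrite scaler0; exact: TensHomog0.
- by rewrite scalerDr; exact: TensHomogD.
rewrite [_ *: _]tens_act_pure; apply: (TensHomogPure _ hm (ghomogZ hq hs)).
by rewrite addbA ab.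
Qed.

(* M (x)_R Q as a graded right S-module, with (m (x) q).s = m (x) (q.s). *)
Definition tens_gmod : gmod S := @GMod S (tens B M) tens_grading tens_homogZ.

End TensorModule.

Section TensorFunctor.
Variables (R S : superRing) (Q : gmod S) (B : bimodule R Q).

Section Map.
Variables (M N : gmod R) (f : ghom false M N).

Definition tens_map : tens_gmod B M -> tens_gmod B N :=
  tens_lift (B := B) (fun m q => pure B (f m) q).

Lemma tens_map_balanced : balanced B (fun m q => pure B (f m) q).
Proof.
have fD x y : f (x + y) = f x + f y by rewrite -[x]scale1r ghom_linear !scale1r.
have f0 : f 0 = 0 by apply: (@addrI _ (f 0)); rewrite -fD !addr0.
split=> [m m' q|m q q'|m r q].
- by rewrite fD pureDl.
- by rewrite pureDr.
- by rewrite -[(r : R^c) *: m]addr0 ghom_linear f0 addr0 pureZ.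
Qed.

Lemma tens_map_pure m q : tens_map (pure B m q) = pure B (f m) q.
Proof. exact: (tens_lift_pure tens_map_balanced). Qed.

Lemma tens_mapD : {morph tens_map : x y / x + y}.
Proof. exact: (tens_liftD tens_map_balanced). Qed.

Lemma tens_map0 : tens_map 0 = 0.
Proof. exact: (tens_lift0 tens_map_balanced). Qed.

Lemma tens_map_linear : linear tens_map.
Proof.
move=> s x y; rewrite tens_mapD; congr (_ + _).
elim/tens_ind: x => [|x x' hx hx'|m q].
- by rewrite scaler0 tens_map0 scaler0.
- by rewrite scalerDr !tens_mapD scalerDr hx hx'.
by rewrite [_ *: _]tens_act_pure !tens_map_pure [RHS]tens_act_pure.
Qed.

Lemma tens_map_homog k t : homog (ggrading (tens_gmod B M)) k t ->
  homog (ggrading (tens_gmod B N)) (false (+) k) (tens_map t).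
Proof.
elim=> [|x y _ hx _ hy|i j m q ij hm hq].
- by rewrite tens_map0; exact: TensHomog0.
- by rewrite tens_mapD; exact: TensHomogD.
rewrite tens_map_pure.
by apply: (@TensHomogPure _ _ _ B N _ i j) => //; exact: (ghom_homog f hm).
Qed.

Definition tens_mor : ghom false (tens_gmod B M) (tens_gmod B N) :=
  GHom tens_map_linear tens_map_homog.
End Map.

Lemma tens_mor1 M : tens_mor (gid M) = gid (tens_gmod B M).
Proof.
apply: ghomP => t /=; elim/tens_ind: t => [|x y hx hy|m q].
- exact: tens_map0.
- by rewrite tens_mapD hx hy.
exact: tens_map_pure.
Qed.

Lemma tens_morM (M N P : gmod R) (g : ghom false N P) (f : ghom false M N) :
  tens_mor (gcomp g f : ghom false M P) = gcomp (tens_mor g) (tens_mor f).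
Proof.
apply: ghomP => t /=; elim/tens_ind: t => [|x y hx hy|m q].
- by rewrite !tens_map0.
- by rewrite !tens_mapD hx hy.
by rewrite !tens_map_pure.
Qed.

(* The functor - (x)_R Q. *)
Definition tensor_functor : functor (gmodCat R) (gmodCat S) :=
  @Functor (gmodCat R) (gmodCat S) (tens_gmod B) tens_mor tens_mor1 tens_morM.
End TensorFunctor.

(* An action of F on all homogeneous homomorphisms, i.e. on the graded internal
   Hom, extending its action on the parity-preserving ones.  A functor between
   the categories of parity-preserving morphisms need not have one, and without
   it an odd r : R, whose left multiplication reg R -> reg R is an odd morphism,
   has no action on F (reg R). *)
Record odd_extension (R S : superRing) (F : functor (gmodCat R) (gmodCat S)) :=
  OddExtension {
  hmap :> forall i (M N : gmod R), ghom i M N -> ghom i (F M) (F N);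
  hmap_even : forall (M N : gmod R) (f : ghom false M N),
    hmap f = @fmap _ _ F M N f;
  hmap_comp : forall i j (M N P : gmod R) (g : ghom i N P) (f : ghom j M N),
    hmap (gcomp g f) = gcomp (hmap g) (hmap f)
}.

(* The left action on F (reg R) is the image of left multiplication on reg R. *)
Definition natural_bimodule (R S : superRing)
    (F : functor (gmodCat R) (gmodCat S)) (E : odd_extension F)
    (B : bimodule R (F (reg R))) : Prop :=
  forall i (r : R) (hr : homog (sgrading R) i r) (q : F (reg R)),
    lact B r q = hmap E (lmul hr) q.

(* Main.v *)
(* An equivalence F is full and faithful, hence additive, and these properties
   pass to odd morphisms through parity shifts.  Sending m (x) q to the image of
   q under F(x |-> m x) : F R -> F M defines a natural map eval : M (x)_R Q -> F M.
   It is an epimorphism because the maps x |-> m x : R -> M are jointly epic.  It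
   is a split monomorphism because every phi : M (x)_R Q -> F N factors through
   it: each phi (m (x) -) : F R -> F N comes from a map R -> N, i.e. from an
   element psi m of N, and then phi = F psi o eval; as F is essentially
   surjective, phi may be taken to be an isomorphism.  This avoids the usual
   presentation of M by free modules.  The case of G follows by symmetry. *)
Require Import Defs.
From mathcomp Require Import all_boot all_algebra boolp.

Set Implicit Arguments.
Unset Strict Implicit.
Unset Printing Implicit Defensive.
Import GRing.Theory.
Local Open Scope ring_scope.
Local Arguments gpart : simpl never.

(** * Homogeneous maps, parity shifts and the square of a module *)

Section GHomTheory.
Variables (R : superRing) (i : bool) (M N : gmod R) (f : ghom i M N).

Lemma ghomD : {morph f : x y / x + y}.
Proof. by move=> x y; rewrite -[x]scale1r ghom_linear !scale1r. Qed.

Lemma ghom0 : f 0 = 0.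
Proof. by apply: (@addrI _ (f 0)); rewrite -ghomD !addr0. Qed.

Lemma ghomZ (r : R) : {morph f : x / (r : R^c) *: x}.
Proof. by move=> x; rewrite -[_ *: x]addr0 ghom_linear ghom0 addr0. Qed.

End GHomTheory.

Section GHomAlgebra.
Variables (R : superRing) (i : bool) (M N : gmod R).

Lemma gzero_linear : linear (fun _ : M => 0 : N).
Proof. by move=> a x y; rewrite scaler0 addr0. Qed.

Lemma gzero_homog j (x : M) : homog (ggrading M) j x ->
  homog (ggrading N) (i (+) j) 0.
Proof. by move=> _; exact: homog0. Qed.

Definition gzero : ghom i M N := GHom gzero_linear gzero_homog.

Variables f g : ghom i M N.

Lemma gadd_linear : linear (fun x : M => f x + g x).
Proof. by move=> a x y; rewrite !ghom_linear scalerDr addrACA. Qed.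

Lemma gadd_homog j (x : M) : homog (ggrading M) j x ->
  homog (ggrading N) (i (+) j) (f x + g x).
Proof. by move=> hx; apply: homogD; exact: ghom_homog. Qed.

Definition gadd : ghom i M N := GHom gadd_linear gadd_homog.

End GHomAlgebra.

(* The identity is an odd isomorphism between a module and its parity shift, so
   odd morphisms can be turned into even ones. *)
Section Shift.
Variables (R : superRing) (M : gmod R).
Let shift_homog (i : bool) : M -> Prop := homog (ggrading M) (~~ i).

Lemma shift_span x : exists x0 x1,
  [/\ shift_homog false x0, shift_homog true x1 & x = x0 + x1].
Proof.
have [x0 [x1 [h0 h1 ->]]] := homog_span (ggrading M) x.
by exists x1, x0; split=> //; exact: addrC.
Qed.

Lemma shift_direct x : shift_homog false x -> shift_homog true x -> x = 0.
Proof. by move=> h0 h1; exact: (homog_direct h1 h0). Qed.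

Definition shift_grading : grading M :=
  Grading (fun i => homog_zmod (ggrading M) (~~ i)) shift_span shift_direct.

Lemma shift_homogZ i j (m : M) (r : R) : homog shift_grading i m ->
  homog (sgrading R) j r -> homog shift_grading (i (+) j) ((r : R^c) *: m).
Proof. by rewrite /= /shift_homog -addNb; exact: ghomogZ. Qed.

Definition shift : gmod R := GMod shift_homogZ.

Lemma to_shift_homog j (x : M) : homog (ggrading M) j x ->
  homog (ggrading shift) (true (+) j) x.
Proof. by rewrite /= /shift_homog negbK. Qed.

Lemma of_shift_homog j (x : shift) : homog (ggrading shift) j x ->
  homog (ggrading M) (true (+) j) x.
Proof. by []. Qed.

Definition to_shift : ghom true M shift :=
  @GHom R true M shift id (@gid_linear R M) to_shift_homog.
Definition of_shift : ghom true shift M :=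
  @GHom R true shift M id (@gid_linear R M) of_shift_homog.

End Shift.

Section Square.
Variables (R : superRing) (N : gmod R).

Let square_homog (i : bool) (x : N * N) :=
  homog (ggrading N) i x.1 /\ homog (ggrading N) i x.2.

Lemma square_zmod i : square_homog i 0 /\
  (forall x y, square_homog i x -> square_homog i y -> square_homog i (x - y)).
Proof.
split=> [|x y [hx1 hx2] [hy1 hy2]]; split; by [exact: homog0 | exact: homogB].
Qed.

Lemma square_span x : exists x0 x1,
  [/\ square_homog false x0, square_homog true x1 & x = x0 + x1].
Proof.
pose p i := (gpart (ggrading N) i x.1, gpart (ggrading N) i x.2).
exists (p false), (p true); split; try by split; exact: gpart_homog.
by case: x @p => x y /=; congr pair; exact: gpartE.
Qed.

Lemma square_direct x : square_homog false x -> square_homog true x -> x = 0.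
Proof.
by case: x => x y [hx hy] [kx ky]; congr pair; exact: (homog_direct (g := ggrading N)).
Qed.

Definition square_grading : grading (N * N)%type :=
  Grading square_zmod square_span square_direct.

Lemma square_homogZ i j (m : (N * N)%type) (r : R) :
  homog square_grading i m -> homog (sgrading R) j r ->
  homog square_grading (i (+) j) ((r : R^c) *: m).
Proof. by move=> [h1 h2] hr; split; exact: ghomogZ. Qed.

(** The biproduct of [N] with itself. Its injections, projections and sum map express addition of
    morphisms by composition, which is what a functor preserves. *)
Definition square : gmod R := GMod square_homogZ.

Lemma fst_linear : linear (fun x : square => x.1). Proof. by []. Qed.
Lemma snd_linear : linear (fun x : square => x.2). Proof. by []. Qed.

Lemma sum_linear : linear (fun x : square => x.1 + x.2).
Proof. by move=> a x y /=; rewrite scalerDr addrACA. Qed.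

Lemma inl_linear : linear (fun x : N => (x, 0) : square).
Proof. by move=> a x y; congr pair; rewrite /= scaler0 addr0. Qed.

Lemma inr_linear : linear (fun x : N => (0, x) : square).
Proof. by move=> a x y; congr pair; rewrite /= scaler0 addr0. Qed.

Definition gfst : ghom false square N :=
  @GHom R false square N _ fst_linear (fun j x hx => hx.1).
Definition gsnd : ghom false square N :=
  @GHom R false square N _ snd_linear (fun j x hx => hx.2).
Definition gsum : ghom false square N :=
  @GHom R false square N _ sum_linear (fun j x hx => homogD hx.1 hx.2).
Definition ginl : ghom false N square :=
  @GHom R false N square _ inl_linear (fun j x hx => conj hx (homog0 _ _)).
Definition ginr : ghom false N square :=
  @GHom R false N square _ inr_linear (fun j x hx => conj (homog0 _ _) hx).

End Square.

(** * The regular module: degree of the unit and orbit maps *)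

Lemma homog1 (R : superRing) : homog (sgrading R) false (1 : R).
Proof.
set e := gpart (sgrading R) true (1 : R).
(* For [x] of degree [i], [x * e] has the opposite degree, but [x * e = x - x * e0] also has degree
   [i], so it vanishes. *)
have he x i : homog (sgrading R) i x -> x * e = 0.
  move=> hx; pose e0 := gpart (sgrading R) false (1 : R).
  have hxe0 : homog (sgrading R) i (x * e0).
    by rewrite -[i]addbF; apply: shomogM => //; exact: gpart_homog.
  have hxe : homog (sgrading R) (~~ i) (x * e).
    by rewrite -addbT; apply: shomogM => //; exact: gpart_homog.
  have hxe' : homog (sgrading R) i (x * e).
    have -> : x * e = x - x * e0.
      by apply/eqP; rewrite eq_sym subr_eq addrC -mulrDr -gpartE mulr1.
    exact: homogB.
  by case: i {hx hxe0} hxe hxe' => h h'; apply: (homog_direct (g := sgrading R)).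
have e0 : e = 0.
  rewrite -[e]mul1r [X in X * _](gpartE (sgrading R)) mulrDl.
  by rewrite !(he _ _ (gpart_homog _ _ _)) addr0.
by rewrite (gpartE (sgrading R) 1) -/e e0 addr0; exact: gpart_homog.
Qed.

Section Orbit.
Variables (R : superRing) (M : gmod R).

Section OrbitMap.
Variables (i : bool) (m : M) (hm : homog (ggrading M) i m).

Lemma orbit_linear : linear (fun x : reg R => (x : R^c) *: m).
Proof. by move=> a x y; rewrite scalerDl scalerA. Qed.

Lemma orbit_homog j (x : reg R) : homog (ggrading (reg R)) j x ->
  homog (ggrading M) (i (+) j) ((x : R^c) *: m).
Proof. exact: ghomogZ. Qed.

Definition orbit : ghom i (reg R) M := GHom orbit_linear orbit_homog.

End OrbitMap.

(** Since [x] is [1] acted on by [x], linearity determines [u] by its value at [1]. *)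
Lemma ghom_reg i (u : ghom i (reg R) M) (hu : homog (ggrading M) i (u (1 : R))) :
  u = orbit hu.
Proof.
apply: ghomP => x /=; rewrite -(ghomZ u x); congr (u _).
exact/esym/(mul1r (x : R)).
Qed.

End Orbit.

(** * Fullness and faithfulness of mutually inverse functors *)

Section InverseFunctors.
Variables (C D : category) (F : functor C D) (G : functor D C).

(** Naturality recovers [f] from [fmap F f] as [eta Y] after [fmap G (fmap F f)] after [eta' X]. *)
Lemma inverse_faithful : nat_isomorphic (functor_comp G F) (functor_id C) ->
  forall X Y (f g : mor X Y), fmap F f = fmap F g -> f = g.
Proof.
case=> eta [eta' [nat _ etaK']] X Y f g efg.
rewrite -[f]compm1 -[g]compm1 -(etaK' X).
by rewrite !Defs.compA; have /= <- := nat _ _ f; rewrite efg; have /= -> := nat _ _ g.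
Qed.

End InverseFunctors.

Lemma inverse_full (C D : category) (F : functor C D) (G : functor D C) :
  mutually_inverse F G ->
  forall X Y (v : mor (F X) (F Y)), exists w : mor X Y, fmap F w = v.
Proof.
move=> [iGF iFG] X Y v; have Gfaithful := inverse_faithful iFG.
case: iGF => eta [eta' [nat etaK etaK']].
(* This is [fmap G v] transported along the isomorphism of [GF] with the identity. Naturality gives
   [GF w = G v], and [G] is faithful. *)
exists (Defs.comp (eta Y) (Defs.comp (fmap G v) (eta' X))); apply: Gfaithful.
set w := Defs.comp _ _; have /= := nat _ _ w => /(congr1 (Defs.comp (eta' Y))).
rewrite Defs.compA etaK comp1m => /= ->; rewrite /w -!Defs.compA etaK compm1.
by rewrite Defs.compA etaK comp1m.
Qed.

Lemma nat_isomorphic_sym (C D : category) (F G : functor C D) :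
  nat_isomorphic F G -> nat_isomorphic G F.
Proof.
case=> eta [eta' [nat etaK etaK']]; exists eta', eta; split=> // X Y f.
rewrite -[fmap G f]compm1 -(etaK' X) [Defs.comp (fmap G f) _]Defs.compA -nat.
by rewrite !Defs.compA etaK comp1m.
Qed.

(** * Fullness, faithfulness and additivity in both parities *)

Section OddExtension.
Variables (R S : superRing) (F : functor (gmodCat R) (gmodCat S)).
Variable E : odd_extension F.

Lemma hmap_compE i j (M N P : gmod R) (g : ghom i N P) (f : ghom j M N) x :
  hmap E (gcomp g f) x = hmap E g (hmap E f x).
Proof. by rewrite hmap_comp. Qed.

Lemma hmap_gid (M : gmod R) : hmap E (gid M) = gid (F M).
Proof. by rewrite hmap_even; exact: (fmap1 F). Qed.

Lemma hmap_of_to_shift (M : gmod R) x :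
  hmap E (of_shift M) (hmap E (to_shift M) x) = x.
Proof.
rewrite -hmap_compE.
have -> : gcomp (of_shift M) (to_shift M) = gid M by exact: ghomP.
by rewrite hmap_gid.
Qed.

Hypothesis evenF_full : forall (M N : gmod R) (v : ghom false (F M) (F N)),
  exists w : ghom false M N, hmap E w = v.
Hypothesis evenF_faithful : forall (M N : gmod R) (f g : ghom false M N),
  hmap E f = hmap E g -> f = g.

Lemma hmap_full i (M N : gmod R) (v : ghom i (F M) (F N)) :
  exists w : ghom i M N, hmap E w = v.
Proof.
case: i v => v; last exact: evenF_full.
(* The composite of two odd maps is even, so it lifts; composing the lift with [of_shift N] undoes
   the shift. *)
have [w hw] := evenF_full (gcomp (hmap E (to_shift N)) v).
exists (gcomp (of_shift N) w); apply: ghomP => x.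
by rewrite (hmap_compE (of_shift N) w) hw /= hmap_of_to_shift.
Qed.

Lemma hmap_faithful i (M N : gmod R) (f g : ghom i M N) :
  hmap E f =1 hmap E g -> f =1 g.
Proof.
case: i f g => f g efg; last first.
  by have -> : f = g by apply/evenF_faithful/ghomP.
have e : gcomp (to_shift N) f = gcomp (to_shift N) g.
  apply: evenF_faithful; apply: ghomP => x.
  by rewrite (hmap_compE (to_shift N) f) (hmap_compE (to_shift N) g) efg.
by move=> x; exact: (congr1 (fun h : ghom false M (shift N) => h x) e).
Qed.

Lemma even_hmap_gzero (M N : gmod R) x : hmap E (gzero false M N) x = 0.
Proof.
(* Any [w] composed with the zero map is zero. For [w] lying over the zero endomorphism of [F N]
   this gives [F 0 = F w \o F 0 = 0]. *)
have [w hw] := evenF_full (gzero false (F N) (F N)).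
have {1}-> : gzero false M N = gcomp w (gzero false M N).
  by apply: ghomP => y /=; rewrite ghom0.
by rewrite (hmap_compE w) hw.
Qed.

(* By fullness [hmap E (ginl N) \o hmap E f + hmap E (ginr N) \o hmap E g] is
   the image of some [w], which faithfulness identifies with the pairing of
   [f] and [g]; composing with [gsum N] yields additivity. *)
Lemma even_hmapD (M N : gmod R) (f g : ghom false M N) x :
  hmap E (gadd f g) x = hmap E f x + hmap E g x.
Proof.
pose b : ghom false (F M) (F (square N)) :=
  gadd (gcomp (hmap E (ginl N)) (hmap E f)) (gcomp (hmap E (ginr N)) (hmap E g)).
have [w hw] := evenF_full b.
have cancelE (k : ghom false (square N) N) (h : ghom false N (square N)) l :
    gcomp k h = l -> forall y, hmap E k (hmap E h y) = hmap E l y.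
  by move=> <- y; rewrite hmap_compE.
have c11 : gcomp (gfst N) (ginl N) = gid N by exact: ghomP.
have c12 : gcomp (gfst N) (ginr N) = gzero false N N by exact: ghomP.
have c21 : gcomp (gsnd N) (ginl N) = gzero false N N by exact: ghomP.
have c22 : gcomp (gsnd N) (ginr N) = gid N by exact: ghomP.
have s1 : gcomp (gsum N) (ginl N) = gid N.
  by apply: ghomP => y /=; rewrite addr0.
have s2 : gcomp (gsum N) (ginr N) = gid N.
  by apply: ghomP => y /=; rewrite add0r.
have w1 : gcomp (gfst N) w = f.
  apply: evenF_faithful; apply: ghomP => y.
  rewrite (hmap_compE (gfst N) w) hw /= ghomD (cancelE _ _ _ c11) (cancelE _ _ _ c12).
  by rewrite hmap_gid even_hmap_gzero addr0.
have w2 : gcomp (gsnd N) w = g.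
  apply: evenF_faithful; apply: ghomP => y.
  rewrite (hmap_compE (gsnd N) w) hw /= ghomD (cancelE _ _ _ c21) (cancelE _ _ _ c22).
  by rewrite hmap_gid even_hmap_gzero add0r.
have -> : gadd f g = gcomp (gsum N) w by apply: ghomP => y; rewrite -w1 -w2.
rewrite (hmap_compE (gsum N) w) hw /= ghomD (cancelE _ _ _ s1) (cancelE _ _ _ s2).
by rewrite hmap_gid.
Qed.

Lemma hmapD i (M N : gmod R) (f g : ghom i M N) x :
  hmap E (gadd f g) x = hmap E f x + hmap E g x.
Proof.
case: i f g => f g; last exact: even_hmapD.
have toE (h : ghom true M N) : hmap E (to_shift N) (hmap E h x) =
    hmap E (gcomp (to_shift N) h : ghom false _ _) x.
  exact: (esym (hmap_compE (to_shift N) h x)).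
(* The odd case is carried to maps into [shift N], which are even, and back. *)
rewrite -[LHS]hmap_of_to_shift -[hmap E f x]hmap_of_to_shift.
rewrite -[hmap E g x]hmap_of_to_shift -ghomD !toE -even_hmapD.
congr (hmap E (of_shift N) _).
by have -> : gcomp (to_shift N) (gadd f g) =
  gadd (gcomp (to_shift N) f) (gcomp (to_shift N) g) :> ghom false _ _ by exact: ghomP.
Qed.

Lemma hmap_gzero i (M N : gmod R) x : hmap E (gzero i M N) x = 0.
Proof.
have e : gadd (gzero i M N) (gzero i M N) = gzero i M N.
  by apply: ghomP => y /=; rewrite addr0.
by apply: (@addrI _ (hmap E (gzero i M N) x)); rewrite -hmapD e addr0.
Qed.

(** * Elements of [M] as maps from [F R] to [F M], and the bimodule structure on [F R] *)

Local Notation Q := (F (reg R)).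

(* [act m q] is the image of q under F(x |-> m x) : F R -> F M, extended
   additively from homogeneous m; on M = R it is the left action of R on Q. *)
Definition act (M : gmod R) (m : M) (q : Q) : F M :=
  hmap E (orbit (gpart_homog (ggrading M) false m)) q +
  hmap E (orbit (gpart_homog (ggrading M) true m)) q.

Lemma orbit_eq (M : gmod R) i (m m' : M) (hm : homog (ggrading M) i m)
  (hm' : homog (ggrading M) i m') : m = m' -> orbit hm = orbit hm'.
Proof. by move=> e; apply: ghomP => x /=; rewrite e. Qed.

(** The component of the other degree is zero, so its orbit map is the zero map, which [hmap E]
    preserves. *)
Lemma act_homogE (M : gmod R) i (m : M) (hm : homog (ggrading M) i m) q :
  act m q = hmap E (orbit hm) q.
Proof.
have z j (h : homog (ggrading M) j 0) : hmap E (orbit h) q = 0.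
  rewrite -(@hmap_gzero j (reg R) M q); congr (hmap E _ q).
  by apply: ghomP => x /=; rewrite scaler0.
have h0 := homog0 (ggrading M) (~~ i).
rewrite /act; case: i hm h0 => hm h0.
  rewrite (orbit_eq _ h0 (gpart_neq (i := false) hm)) z add0r.
  by rewrite (orbit_eq _ hm (gpart_id hm)).
rewrite (orbit_eq _ h0 (gpart_neq (i := true) hm)) z addr0.
by rewrite (orbit_eq _ hm (gpart_id hm)).
Qed.

Lemma actDl (M : gmod R) (m m' : M) q : act (m + m') q = act m q + act m' q.
Proof.
rewrite /act addrACA -!hmapD.
by congr (_ + _); congr (hmap E _ q); apply: ghomP => x /=; rewrite gpartD scalerDr.
Qed.

Lemma actDr (M : gmod R) (m : M) q q' : act m (q + q') = act m q + act m q'.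
Proof. by rewrite /act !ghomD addrACA. Qed.

Lemma actE (M : gmod R) (m : M) q :
  act m q = act (gpart (ggrading M) false m) q + act (gpart (ggrading M) true m) q.
Proof. by rewrite -actDl -gpartE. Qed.

Lemma actZr (M : gmod R) (m : M) (s : S) q :
  act m ((s : S^c) *: q) = (s : S^c) *: act m q.
Proof. by rewrite /act !ghomZ scalerDr. Qed.

Lemma act_homog (M : gmod R) i j (m : M) q : homog (ggrading M) i m ->
  homog (ggrading Q) j q -> homog (ggrading (F M)) (i (+) j) (act m q).
Proof. by move=> hm hq; rewrite (act_homogE hm); exact: ghom_homog. Qed.

(** Following the orbit map of [m] by [f] gives the orbit map of [f m]. Taking an orbit map for [f]
    yields [actM], hence both associativity on [Q] and balancedness. *)
Lemma hmap_act i (M N : gmod R) (f : ghom i M N) (m : M) q :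
  hmap E f (act m q) = act (f m) q.
Proof.
have h j (m' : M) (hm : homog (ggrading M) j m') :
    hmap E f (act m' q) = act (f m') q.
  rewrite (act_homogE hm) (act_homogE (ghom_homog f hm)) -hmap_compE.
  by congr (hmap E _ q); apply: ghomP => x /=; rewrite ghomZ.
by rewrite actE ghomD !(h _ _ (gpart_homog _ _ _)) -actDl -ghomD -gpartE.
Qed.

Lemma actM (M : gmod R) (m : M) (r : R) q :
  act m (act (r : reg R) q) = act ((r : R^c) *: m) q.
Proof.
have h j (m' : M) (hm : homog (ggrading M) j m') :
    act m' (act (r : reg R) q) = act ((r : R^c) *: m') q.
  by rewrite (act_homogE hm) hmap_act.
by rewrite actE !(h _ _ (gpart_homog _ _ _)) -actDl -scalerDr -gpartE.
Qed.

Lemma act1 q : act ((1 : R) : reg R) q = q.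
Proof.
rewrite (act_homogE (M := reg R) (homog1 R)).
have -> : orbit (homog1 R : homog (ggrading (reg R)) false (1 : R)) = gid (reg R).
  by apply: ghomP => x /=; exact: (mul1r (x : R)).
by rewrite hmap_gid.
Qed.

Lemma regular_actM (r r' : R) q :
  act ((r * r' : R) : reg R) q = act (r : reg R) (act (r' : reg R) q).
Proof. by rewrite actM. Qed.

Definition regular_bimodule : bimodule R Q :=
  @Bimodule R S Q (@act (reg R)) (@actDl (reg R)) (@actDr (reg R))
    regular_actM act1 (@actZr (reg R)) (@act_homog (reg R)).

Lemma regular_bimodule_natural : natural_bimodule E regular_bimodule.
Proof.
move=> i r hr q /=.
rewrite (act_homogE (M := reg R) (hr : homog (ggrading (reg R)) i r)).
by congr (hmap E _ q); exact: ghomP.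
Qed.

(** For homogeneous [x], faithfulness turns the vanishing of [act x] into that of its orbit map,
    whose value at [1] is [x]. *)
Lemma act_inj (M : gmod R) (m m' : M) : act m =1 act m' -> m = m'.
Proof.
have homog_case i (x : M) : homog (ggrading M) i x -> (forall q, act x q = 0) -> x = 0.
  move=> hx x0; have := @hmap_faithful i (reg R) M (orbit hx) (gzero i (reg R) M).
  rewrite -[RHS]/(gzero i (reg R) M (1 : R)) => <-; first by rewrite /= scale1r.
  by move=> q; rewrite hmap_gzero -act_homogE.
suff kernel (x : M) : (forall q, act x q = 0) -> x = 0.
  move=> e; apply/eqP; rewrite -subr_eq0; apply/eqP/kernel => q.
  by apply: (@addIr _ (act m' q)); rewrite add0r -actDl subrK.
move=> x0.
(* On a homogeneous [q] the two components of [x] produce elements of opposite degrees with sum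
   zero, so each vanishes. *)
have part_homog i j q : homog (ggrading Q) j q -> act (gpart (ggrading M) i x) q = 0.
  move=> hq; have h k := act_homog (gpart_homog (ggrading M) k x) hq.
  have := x0 q; rewrite actE => /eqP; rewrite addr_eq0 => /eqP e.
  have z : act (gpart (ggrading M) false x) q = 0.
    have h1 := homogN (h true); rewrite -e in h1.
    by case: j {hq e} h h1 => h h1; move: (h false) => h0;
       apply: (homog_direct (g := ggrading (F M))).
  by case: i => //; apply/eqP; rewrite -oppr_eq0 -e z.
have part i : gpart (ggrading M) i x = 0.
  apply: (homog_case i); first exact: gpart_homog.
  move=> q; rewrite (gpartE (ggrading Q) q) actDr.
  by rewrite !(part_homog _ _ _ (gpart_homog _ _ _)) addr0.
by rewrite (gpartE (ggrading M) x) !part addr0.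
Qed.

Local Notation B := regular_bimodule.

(** * The evaluation map, its factorization property and its inverse *)

Section Evaluation.
Variable M : gmod R.

Lemma act_balanced : balanced B (@act M).
Proof.
by split=> [m m1 q|m q q1|m r q]; [exact: actDl | exact: actDr | rewrite /= -actM].
Qed.

Definition eval_fun : tens_gmod B M -> F M := tens_lift (B := B) (@act M).

Lemma eval_pure m q : eval_fun (pure B m q) = act m q.
Proof. exact: (tens_lift_pure act_balanced). Qed.

Lemma evalD : {morph eval_fun : x y / x + y}.
Proof. exact: (tens_liftD act_balanced). Qed.

Lemma eval0 : eval_fun 0 = 0.
Proof. exact: (tens_lift0 act_balanced). Qed.

Lemma eval_linear : linear eval_fun.
Proof.
move=> s x y; rewrite evalD; congr (_ + _).
elim/tens_ind: x => [|x x' hx hx'|m q].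
- by rewrite scaler0 eval0 scaler0.
- by rewrite scalerDr !evalD scalerDr hx hx'.
by rewrite [_ *: _]tens_act_pure !eval_pure actZr.
Qed.

Lemma eval_homog k t : homog (ggrading (tens_gmod B M)) k t ->
  homog (ggrading (F M)) (false (+) k) (eval_fun t).
Proof.
elim=> [|x y _ hx _ hy|i j m q <- hm hq].
- by rewrite eval0; exact: homog0.
- by rewrite evalD; exact: homogD.
by rewrite eval_pure; exact: (act_homog hm hq).
Qed.

Definition eval : ghom false (tens_gmod B M) (F M) := GHom eval_linear eval_homog.

Lemma tens_ghom_ext (N : gmod S) i (f g : ghom i (tens_gmod B M) N) :
  (forall m q, f (pure B m q) = g (pure B m q)) -> f = g.
Proof.
move=> e; apply: ghomP; elim/tens_ind => [|x y hx hy|m q]; first by rewrite !ghom0.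
  by rewrite !ghomD hx hy.
exact: e.
Qed.

Section Factorization.
Variables (N : gmod R) (phi : ghom false (tens_gmod B M) (F N)).

Lemma pure_right_linear m : linear (fun q : Q => phi (pure B m q)).
Proof.
move=> s x y; rewrite pureDr ghomD; congr (_ + _).
by rewrite -ghomZ [X in _ = phi X]tens_act_pure.
Qed.

Lemma pure_right_homog i m : homog (ggrading M) i m ->
  forall j q, homog (ggrading Q) j q ->
  homog (ggrading (F N)) (i (+) j) (phi (pure B m q)).
Proof.
move=> hm j q hq; apply: (@ghom_homog _ _ _ _ phi (i (+) j)).
exact: TensHomogPure erefl hm hq.
Qed.

Lemma homog_factor i m : homog (ggrading M) i m ->
  exists2 y : N, homog (ggrading N) i y & forall q, phi (pure B m q) = act y q.
Proof.
(* For [m] of degree [i], the map [q |-> phi (m (x) q)] from [F R] to [F N] has degree [i], so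
   fullness in both parities is required here. *)
move=> hm; have [u hu] := hmap_full (GHom (@pure_right_linear m) (pure_right_homog hm)).
have hu1 : homog (ggrading N) i (u (1 : R)).
  by have := ghom_homog u (homog1 R : homog (ggrading (reg R)) _ _); rewrite addbF.
exists (u (1 : R)) => // q.
by rewrite (act_homogE hu1) -ghom_reg hu.
Qed.

Lemma factor_exists m : exists y : N, forall q, phi (pure B m q) = act y q.
Proof.
have [y _ hy] := homog_factor (gpart_homog (ggrading M) false m).
have [z _ hz] := homog_factor (gpart_homog (ggrading M) true m).
by exists (y + z) => q; rewrite actDl -hy -hz -ghomD -pureDl -gpartE.
Qed.

(* [psi m] is the unique element with [phi (m (x) q) = act (psi m) q]. *)
Lemma eval_factor : exists psi : ghom false M N, gcomp (hmap E psi) eval = phi.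
Proof.
have [psi hpsi] := choice factor_exists.
have psi_linear : linear psi.
  move=> r x y; apply: act_inj => q.
  by rewrite actDl -actM -!hpsi pureDl ghomD pureZ.
have psi_homog j x : homog (ggrading M) j x -> homog (ggrading N) (false (+) j) (psi x).
  (* The chosen [psi x] carries no information on degree; uniqueness identifies it with the
     homogeneous [y]. *)
  move=> hx; have [y hy e] := homog_factor hx.
  by have -> : psi x = y by apply: act_inj => q; rewrite -hpsi -e.
exists (GHom psi_linear psi_homog); apply: tens_ghom_ext => m q /=.
by rewrite eval_pure hmap_act hpsi.
Qed.

End Factorization.

(** Fullness gives preimages [g'] and [h']. Evaluated on pure tensors, the equation says that [g' m]
    and [h' m] act alike, so [act_inj] applies. *)
Lemma eval_epi (N : gmod R) (g h : ghom false (F M) (F N)) :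
  gcomp g eval = gcomp h eval -> g = h.
Proof.
have [g' <-] := evenF_full g; have [h' <-] := evenF_full h => e.
congr (hmap E _); apply: ghomP => m; apply: act_inj => q.
have /= := congr1 (fun k : ghom false (tens_gmod B M) (F N) => k (pure B m q)) e.
by rewrite eval_pure !hmap_act.
Qed.

End Evaluation.

Lemma eval_nat (M N : gmod R) (f : ghom false M N) :
  gcomp (eval N) (tens_mor B f) = gcomp (hmap E f) (eval M).
Proof.
by apply: tens_ghom_ext => m q /=; rewrite tens_map_pure !eval_pure hmap_act.
Qed.

Hypothesis F_ess_surj : forall T : gmod S, exists (N : gmod R)
  (phi : ghom false T (F N)) (phi' : ghom false (F N) T), gcomp phi' phi = gid T.

(** Factoring [phi] through [eval M] and composing with its retraction [phi'] gives a left inverse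
    [s]. *)
Lemma eval_iso (M : gmod R) : exists s : ghom false (F M) (tens_gmod B M),
  gcomp s (eval M) = gid _ /\ gcomp (eval M) s = gid _.
Proof.
have [N [phi [phi' phiK]]] := F_ess_surj (tens_gmod B M).
have [psi hpsi] := eval_factor phi.
have sK : gcomp (gcomp phi' (hmap E psi)) (eval M) = gid _ :> ghom false _ _.
  by rewrite -gcompA hpsi.
(* It is also a right inverse: [eval \o s] and the identity agree after precomposition with [eval],
   which cancels. *)
exists (gcomp phi' (hmap E psi)); split=> //; apply: eval_epi.
by rewrite -gcompA sK gcompm1 gcomp1m.
Qed.

Lemma nat_isomorphic_tensor : nat_isomorphic F (tensor_functor B).
Proof.
apply: nat_isomorphic_sym; pose s M := cid (eval_iso M).
exists eval, (fun M => sval (s M)); split=> [M N f|M|M].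
- by rewrite /= -(hmap_even E); exact: eval_nat.
- exact: (svalP (s M)).1.
exact: (svalP (s M)).2.
Qed.

End OddExtension.

(** * Eilenberg-Watts for one functor of the equivalence, then for both *)

Lemma eilenberg_watts (R S : superRing)
    (F : functor (gmodCat R) (gmodCat S)) (G : functor (gmodCat S) (gmodCat R))
    (E : odd_extension F) : mutually_inverse F G ->
  exists B : bimodule R (F (reg R)),
    natural_bimodule E B /\ nat_isomorphic F (tensor_functor B).
Proof.
move=> FG.
have Ffull (M N : gmod R) (v : ghom false (F M) (F N)) :
    exists w : ghom false M N, hmap E w = v.
  by have [w hw] := inverse_full FG v; exists w; rewrite hmap_even.
have Ffaithful (M N : gmod R) (f g : ghom false M N) : hmap E f = hmap E g -> f = g.
  by rewrite !hmap_even; exact: (inverse_faithful FG.1).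
have Fsurj (T : gmod S) : exists (N : gmod R)
    (phi : ghom false T (F N)) (phi' : ghom false (F N) T), gcomp phi' phi = gid T.
  case: FG.2 => eta [eta' [_ _ etaK]].
  (* [T] is isomorphic to [F (G T)] through the counit of the equivalence. *)
  by exists (G T), (eta' T), (eta T); exact: etaK.
exists (regular_bimodule Ffull Ffaithful); split.
  exact: regular_bimodule_natural.
exact: nat_isomorphic_tensor.
Qed.

Theorem theorem3p2p4 (R S : superRing)
    (F : functor (gmodCat R) (gmodCat S)) (G : functor (gmodCat S) (gmodCat R))
    (EF : odd_extension F) (EG : odd_extension G) :
  mutually_inverse F G ->
  let Q := F (reg R) in
  let P := G (reg S) in
  exists (BP : bimodule S P) (BQ : bimodule R Q),
    [/\ natural_bimodule EG BP, natural_bimodule EF BQ,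
        nat_isomorphic F (tensor_functor BQ)
      & nat_isomorphic G (tensor_functor BP)].
Proof.
move=> [GF FG] Q P.
have [BQ [natQ isoQ]] := eilenberg_watts EF (conj GF FG).
have [BP [natP isoP]] := eilenberg_watts EG (conj FG GF).
by exists BP, BQ.
Qed.
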